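(* Let $A\in M(8,\mathbb{C})$ satisfy $A\neq0$, $\mathbb{J}A={}^tA\,\mathbb{J}$, $A^2=\lambda E$ for some $\lambda\in\mathbb{C}$ ($E$ the identity matrix), and $\operatorname{tr}A=0$. Assume moreover that, writing $A$ as a $4\times4$ array of $2\times2$ blocks, the diagonal blocks of $A$ are, in order, $$\begin{pmatrix}0&0\\0&0\end{pmatrix},\ \begin{pmatrix}\xi_1&0\\0&\xi_1\end{pmatrix},\ \begin{pmatrix}\xi_2&0\\0&\xi_2\end{pmatrix},\ \begin{pmatrix}\xi_3&0\\0&\xi_3\end{pmatrix},\qquad \sum_{i=1}^3\xi_i=0$$ with $\xi_i\in\mathbb{C}$ (no further condition on the off-diagonal blocks). Then there exists an element $X\in\mathfrak{J}^{\mathbb{C}}$ such that $$X\circ X=0,\qquad \rho(g(X))=A.$$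
   Context: Octonions: $\mathbb{H}$ is the quaternion algebra over $\mathbb{R}$ with basis $e_0=1,e_1,e_2,e_3$ ($e_i^2=-1$, $e_1e_2=-e_2e_1=e_3$ and cyclic permutations), $\theta$ is quaternion conjugation. The Cayley algebra is $\mathcal{O}=\mathbb{H}\oplus\mathbb{H}e_4$ with product $(a+be_4)(h+ke_4)=ah-\theta(k)b+\{ka+b\theta(h)\}e_4$, and $\theta(h+ke_4)=\theta(h)-ke_4$. Jordan algebra: $\mathfrak{J}=\{X\in M(3,\mathcal{O}) : \theta({}^tX)=X\}$ with $X\circ Y=\frac12(XY+YX)$; $\mathfrak{J}^{\mathbb{C}}=\mathfrak{J}\otimes_{\mathbb{R}}\mathbb{C}$ with $\circ$ and $\theta$ extended complex (bi)linearly. The map $g$: an element of $\mathfrak{J}^{\mathbb{C}}$, $$X=\begin{pmatrix}\xi_1&x_3&\theta(x_2)\\ \theta(x_3)&\xi_2&x_1\\ x_2&\theta(x_1)&\xi_3\end{pmatrix},\quad \xi_i\in\mathbb{C},\ x_i=m_i+a_ie_4,\ m_i,a_i\in\mathbb{H}\otimes\mathbb{C},$$ is decomposed as $X=M+\mathcal{A}e_4$ with $$M=\begin{pmatrix}\xi_1&m_3&\theta(m_2)\\ \theta(m_3)&\xi_2&m_1\\ m_2&\theta(m_1)&\xi_3\end{pmatrix},\qquad \mathcal{A}=\begin{pmatrix}0&a_3&-a_2\\ -a_3&0&a_1\\ a_2&-a_1&0\end{pmatrix}.$$ Let $\mathfrak{J}(4,\mathbb{H})$ be the Jordan algebra of $4\times4$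 quaternionic Hermitian matrices and $\mathfrak{J}(4,\mathbb{H})_0$ its trace-zero subspace. Then $g:\mathfrak{J}^{\mathbb{C}}\to\mathfrak{J}(4,\mathbb{H})_0\otimes\mathbb{C}$ is $$g(X)=\begin{pmatrix}\frac12\operatorname{tr}M& ia_1&ia_2&ia_3\\ i\theta(a_1)&&&\\ i\theta(a_2)&&M-\frac12\operatorname{tr}M\cdot E&\\ i\theta(a_3)&&&\end{pmatrix},$$ where $i=\sqrt{-1}\in\mathbb{C}$ is the scalar of the complexification and the lower right block is $3\times3$. The map $\rho$: $\rho:\mathbb{H}\otimes\mathbb{C}\to M(2,\mathbb{C})$ is the algebra isomorphism $$\rho\Bigl(\sum_{j=0}^3z_je_j\Bigr)=\begin{pmatrix}z_0+z_1i&z_2+z_3i\\-z_2+z_3i&z_0-z_1i\end{pmatrix},$$ and $\rho:\mathfrak{J}(4,\mathbb{H})\otimes\mathbb{C}\to M(8,\mathbb{C})$ is $\rho((h_{ij}))=(\rho(h_{ij}))$ (blockwise). $\mathbb{J}\in M(8,\mathbb{C})$ is the block diagonal matrix with four diagonal blocks equal to $J=\begin{pmatrix}0&1\\-1&0\end{pmatrix}$. *)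

(* Defs.v *)
From HB Require Import structures.
From mathcomp Require Import all_boot all_order all_algebra.
From mathcomp Require Import complex mxtens reals.
From mathcomp Require Import ring.

Set Implicit Arguments.
Unset Strict Implicit.
Unset Printing Implicit Defensive.

Import Order.TTheory GRing.Theory Num.Theory.
Local Open Scope ring_scope.

(* The real algebras H, O and J are defined by structure constants over an    *)
(* arbitrary coefficient ring K.  Their complexifications are the same        *)
(* algebras with K = R[i]: [quat R[i]] is H (x) C, [oct R[i]] is O (x) C, and *)
(* [J3 R[i]] is J (x) C.  Products are K-bilinear and conjugations K-linear,  *)
(* so over R[i] neither conjugation touches the scalars.                      *)

Section Quaternions.
Variable K : comNzRingType.

(* The row (z0, z1, z2, z3) stands for z0 e0 + z1 e1 + z2 e2 + z3 e3. *)
Definition quat : Type := 'rV[K]_4.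
HB.instance Definition _ := GRing.Lmodule.copy quat 'rV[K]_4.

Definition qco (h : quat) (j : 'I_4) : K := (h : 'rV[K]_4) 0 j.

Definition mkq (z0 z1 z2 z3 : K) : quat :=
  \row_(j < 4) [:: z0; z1; z2; z3]`_j.

Definition qbasis (j : 'I_4) : quat := delta_mx 0 j : 'rV[K]_4.

Definition qmul (p q : quat) : quat :=
  mkq (qco p 0 * qco q 0 - qco p 1 * qco q 1
       - qco p 2%:R * qco q 2%:R - qco p 3%:R * qco q 3%:R)
      (qco p 0 * qco q 1 + qco p 1 * qco q 0
       + qco p 2%:R * qco q 3%:R - qco p 3%:R * qco q 2%:R)
      (qco p 0 * qco q 2%:R - qco p 1 * qco q 3%:R
       + qco p 2%:R * qco q 0 + qco p 3%:R * qco q 1)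
      (qco p 0 * qco q 3%:R + qco p 1 * qco q 2%:R
       - qco p 2%:R * qco q 1 + qco p 3%:R * qco q 0).

Definition qone : quat := mkq 1 0 0 0.

Definition qconj (h : quat) : quat :=
  mkq (qco h 0) (- qco h 1) (- qco h 2%:R) (- qco h 3%:R).

Lemma qcoE z0 z1 z2 z3 :
  (qco (mkq z0 z1 z2 z3) 0 = z0) * (qco (mkq z0 z1 z2 z3) 1 = z1)
  * (qco (mkq z0 z1 z2 z3) 2%:R = z2) * (qco (mkq z0 z1 z2 z3) 3%:R = z3).
Proof. by rewrite /qco !mxE. Qed.

Lemma qcoD p q j : qco (p + q) j = qco p j + qco q j.
Proof. by rewrite /qco mxE. Qed.

Lemma qcoN p j : qco (- p) j = - qco p j.
Proof. by rewrite /qco mxE. Qed.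

Lemma qcoZ a p j : qco (a *: p) j = a * qco p j.
Proof. by rewrite /qco mxE. Qed.

Lemma qco0 j : qco 0 j = 0.
Proof. by rewrite /qco mxE. Qed.

Lemma qcoP (p q : quat) :
  qco p 0 = qco q 0 -> qco p 1 = qco q 1 -> qco p 2%:R = qco q 2%:R ->
  qco p 3%:R = qco q 3%:R -> p = q.
Proof.
move=> h0 h1 h2 h3; apply/rowP => -[[|[|[|[|j]]]] hj] //.
- by rewrite (_ : Ordinal hj = 0) //; apply: val_inj.
- by rewrite (_ : Ordinal hj = 1) //; apply: val_inj.
- by rewrite (_ : Ordinal hj = 2%:R) //; apply: val_inj.
- by rewrite (_ : Ordinal hj = 3%:R) //; apply: val_inj.
Qed.

Fact qmulA : associative qmul.
Proof. by move=> p q r; apply: qcoP; rewrite !qcoE; ring. Qed.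
Fact qmul1l : left_id qone qmul.
Proof. by move=> p; apply: qcoP; rewrite !qcoE; ring. Qed.
Fact qmul1r : right_id qone qmul.
Proof. by move=> p; apply: qcoP; rewrite !qcoE; ring. Qed.
Fact qmulDl : left_distributive qmul +%R.
Proof. by move=> p q r; apply: qcoP; rewrite !qcoD !qcoE !qcoD; ring. Qed.
Fact qmulDr : right_distributive qmul +%R.
Proof. by move=> p q r; apply: qcoP; rewrite !qcoD !qcoE !qcoD; ring. Qed.
Fact qone_neq0 : qone != 0.
Proof.
by apply/eqP => /(congr1 (qco^~ 0)) /eqP; rewrite qcoE qco0 oner_eq0.
Qed.

HB.instance Definition _ := GRing.Zmodule_isNzRing.Build quat
  qmulA qmul1l qmul1r qmulDl qmulDr qone_neq0.

Lemma qbasis_table :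
  let e := qbasis in
  [/\ e 0 = 1,
      [/\ e 1 * e 1 = -1, e 2%:R * e 2%:R = -1 & e 3%:R * e 3%:R = -1],
      [/\ e 1 * e 2%:R = e 3%:R, e 2%:R * e 3%:R = e 1
        & e 3%:R * e 1 = e 2%:R]
    & [/\ e 2%:R * e 1 = - e 3%:R, e 3%:R * e 2%:R = - e 1
        & e 1 * e 3%:R = - e 2%:R]].
Proof.
by split; [|split|split|split]; apply: qcoP;
  rewrite ?qcoN !qcoE /qco ?mxE /=; ring.
Qed.

End Quaternions.

Section Octonions.
Variable K : comNzRingType.

(* The pair (a, b) stands for a + b e4.  Only the K-module structure of the   *)
(* product type is inherited, not its componentwise ring structure.           *)
Definition oct : Type := (quat K * quat K)%type.
HB.instance Definition _ := GRing.Lmodule.copy oct (quat K * quat K)%type.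

Definition omul (x y : oct) : oct :=
  (x.1 * y.1 - qconj y.2 * x.2, y.2 * x.1 + x.2 * qconj y.1).

Definition oconj (x : oct) : oct := (qconj x.1, - x.2).

(* [oct] is not associative, hence no ringType and no [*m] on its matrices. *)
Definition omulmx n (X Y : 'M[oct]_n) : 'M[oct]_n :=
  \matrix_(i, j) \sum_k omul (X i k) (Y k j).

Definition J3 : {pred 'M[oct]_3} := [pred X | map_mx oconj X^T == X].

End Octonions.
Arguments J3 : clear implicits.

Definition jordan (K : fieldType) n (X Y : 'M[oct K]_n) : 'M[oct K]_n :=
  map_mx (fun x : oct K => 2^-1 *: x) (omulmx X Y + omulmx Y X).

Section Maps.
Variable R : rcfType.
Local Notation C := R[i].

Definition gM (X : 'M[oct C]_3) : 'M[quat C]_3 :=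
  map_mx (fun x : oct C => x.1) X.

(* a_1, a_2, a_3 are the e4-parts of the entries x_1, x_2, x_3 of X, located  *)
(* at positions (2,3), (3,1), (1,2); with 0-based indices in Z/3, this is     *)
(* position (j+1, j+2) for the j-th one.                                      *)
Definition ga (X : 'M[oct C]_3) (j : 'I_3) : quat C := (X (j + 1) (j + 2%:R)).2.

Definition g (X : 'M[oct C]_3) : 'M[quat C]_4 :=
  let t : quat C := 2^-1 *: \tr (gM X) in
  block_mx (t%:M : 'M_1)
           (\row_(j < 3) ('i%C *: ga X j))
           (\col_(j < 3) ('i%C *: qconj (ga X j)))
           (gM X - t%:M)
  : 'M_(1 + 3).

Definition mx2 (a b c d : C) : 'M[C]_2 :=
  \matrix_(k < 2, l < 2) (nth [::] [:: [:: a; b]; [:: c; d]] k)`_l.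

Definition rho2 (z : quat C) : 'M[C]_2 :=
  mx2 (qco z 0 + qco z 1 * 'i%C)         (qco z 2%:R + qco z 3%:R * 'i%C)
      (- qco z 2%:R + qco z 3%:R * 'i%C) (qco z 0 - qco z 1 * 'i%C).

(* The index 2 * i + k of 'I_8 = 'I_(4 * 2) is [mxtens_index (i, k)]. *)
Definition rho (H : 'M[quat C]_4) : 'M[C]_8 :=
  \matrix_(p < 4 * 2, q < 4 * 2)
    rho2 (H (mxtens_unindex p).1 (mxtens_unindex q).1)
         (mxtens_unindex p).2 (mxtens_unindex q).2.

Definition J2 : 'M[C]_2 := mx2 0 1 (-1) 0.

(* Kronecker product: block diagonal with four blocks J2. *)
Definition JJ : 'M[C]_8 := (1%:M : 'M_4) *t J2.

Definition block2 (A : 'M[C]_8) (i j : 'I_4) : 'M[C]_2 :=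
  \matrix_(k < 2, l < 2)
    (A : 'M_(4 * 2)) (mxtens_index (i, k)) (mxtens_index (j, l)).

End Maps.

(* Main.v *)
Require Import Defs.
From HB Require Import structures.
From mathcomp Require Import all_boot all_order all_algebra.
From mathcomp Require Import complex mxtens reals.
From mathcomp Require Import ring.

Import GRing.Theory.
Local Open Scope ring_scope.

(** Since rho(conj(z)) = J^-1 rho(z)^T J for the 2x2 matrix J, a complex 8x8 matrix A satisfies
    JJ A = A^T JJ exactly when it is rho(H) for a Hermitian 4x4 matrix H over
    H (x) C ([rho_quat_mx], [qconj_quat_mx]); and rho is a ring morphism, so
    A^2 = c E becomes H^2 = c E ([quat_mxM], [quat_mx_scalar]).

    The corner H_00 vanishes by hypothesis and the lower right 3x3 block M has
    trace 0, so the term (1/2) tr M in the definition of g disappears and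
    H = g(X) just says that X = M + cross(a) e4, where i a is the row
    (H_01, H_02, H_03) and cross(a) is the skew 3x3 matrix built from a
    ([ginv], [ginvK]).

    It remains to read X^2 = 0 off H^2 = c E.  The corner of H^2 gives
    c = - sum_l N(a_l), hence the other blocks give
      sum_j a_j M_jk = 0   and   (M^2)_jk = conj(a_j) a_k - delta_jk sum_l N(a_l).
    Since cross(a) has the adjugate-like property
      sum_k conj(cross(a)_kj) cross(a)_ik = conj(a_i) a_j - delta_ij sum_l N(a_l),
    the H-component of (X^2)_ij is zero.  Its e4-component is skew in i and j,
    and off the diagonal it equals, up to sign, sum_j a_j M_jk - a_k tr M for
    the index k different from both ([cayley_mx_sqr0]).  So X^2 vanishes
    already before it is symmetrised into X o X. *)

(** * Quaternions as an algebra with conjugation *)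

Section QuaternionAlgebra.
Variable K : comNzRingType.
Implicit Types (p q : quat K) (c : K).

Fact qscaleAl c p q : c *: (p * q) = (c *: p) * q.
Proof. by apply: qcoP; rewrite !(qcoZ, qcoE); ring. Qed.

Fact qscaleAr c p q : c *: (p * q) = p * (c *: q).
Proof. by apply: qcoP; rewrite !(qcoZ, qcoE); ring. Qed.

HB.instance Definition _ :=
  GRing.Lmodule_isLalgebra.Build K (quat K) qscaleAl.
HB.instance Definition _ :=
  GRing.Lalgebra_isAlgebra.Build K (quat K) qscaleAr.

Fact qconj_is_linear : linear (@qconj K).
Proof.
by move=> c p q; apply: qcoP; rewrite !(qcoD, qcoZ, qcoE); ring.
Qed.
HB.instance Definition _ :=
  GRing.isLinear.Build K (quat K) (quat K) *:%R (@qconj K) qconj_is_linear.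

Lemma mul_qconjC p : p * qconj p = qconj p * p.
Proof. by apply: qcoP; rewrite !qcoE; ring. Qed.

End QuaternionAlgebra.

(** * Indices modulo 3 *)

Lemma I3_cases (i j : 'I_3) : [\/ j = i, j = i + 1 | j = i + 2%:R].
Proof.
have: [|| j == i, j == i + 1 | j == i + 2%:R].
  by case: i j => [[|[|[|i]]] hi] [[|[|[|j]]] hj].
by case/or3P=> /eqP; [constructor 1 | constructor 2 | constructor 3].
Qed.

Lemma I3_neq (i : 'I_3) : ((i == i + 1) = false) * ((i == i + 2%:R) = false).
Proof. by case: i => [[|[|[|i]]] hi]. Qed.

Lemma sum_I3 (V : nmodType) (F : 'I_3 -> V) (i : 'I_3) :
  \sum_k F k = F i + F (i + 1) + F (i + 2%:R).
Proof.
rewrite (reindex_inj (addrI i)) /= !big_ord_recl big_ord0 !addr0 addrA.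
by congr (_ + F _ + F _); apply: val_inj.
Qed.

(** * Octonionic matrices M + cross(a) e4 with square zero *)

Section CrossMatrix.
Variables (K : comNzRingType) (a : 'I_3 -> quat K).

(** The matrix of the vector product with a; its row and column numbers are
    taken modulo 3, so that one formula covers all three entries. *)
Definition cross (i j : 'I_3) : quat K :=
  if j == i + 1 then a (i + 2%:R)
  else if j == i + 2%:R then - a (i + 1) else 0.

(** Listing the entries relative to an arbitrary row i uses the symmetry under
    cyclic shifts, which divides the number of cases below by three. *)
Lemma crossE i :
  (cross i i = 0)
  * (cross i (i + 1) = a (i + 2%:R))
  * (cross i (i + 2%:R) = - a (i + 1))
  * (cross (i + 1) i = - a (i + 2%:R))
  * (cross (i + 1) (i + 1) = 0)
  * (cross (i + 1) (i + 2%:R) = a i)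
  * (cross (i + 2%:R) i = a (i + 1))
  * (cross (i + 2%:R) (i + 1) = - a i)
  * (cross (i + 2%:R) (i + 2%:R) = 0).
Proof.
by do !split; rewrite /cross; case: i => [[|[|[|i]]] hi] //=;
  try congr (- _); try congr a; apply: val_inj.
Qed.

Lemma cross_anti i j : cross j i = - cross i j.
Proof. by case: (I3_cases i j) => ->; rewrite !crossE ?oppr0 ?opprK. Qed.

Definition cayley_mx (M : 'M[quat K]_3) : 'M[oct K]_3 :=
  \matrix_(i, j) ((M i j, cross i j) : oct K).

(** Octonion conjugation negates the e4-component, and [cross] is skew. *)
Lemma cayley_mx_J3 (M : 'M[quat K]_3) :
  (forall i j, qconj (M i j) = M j i) -> cayley_mx M \in J3 K.
Proof.
move=> hM; rewrite inE; apply/eqP/matrixP => i j.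
by rewrite !mxE /oconj /= hM -cross_anti.
Qed.

(** The two equations on M and a are what remains of H^2 = c E, after c is
    eliminated, for the 4x4 Hermitian matrix H with corner 0, first row i a and
    lower right block M. *)
Lemma cayley_mx_sqr0 (M : 'M[quat K]_3) :
  (forall i j, qconj (M i j) = M j i) -> \tr M = 0 ->
  (forall k, \sum_j a j * M j k = 0) ->
  (forall j k, (M *m M) j k =
     qconj (a j) * a k - (\sum_l qconj (a l) * a l) *+ (j == k)) ->
  omulmx (cayley_mx M) (cayley_mx M) = 0.
Proof.
move=> hM trM rowM sqrM; apply/matrixP => i j.
have fstE : (omulmx (cayley_mx M) (cayley_mx M) i j).1 =
    (M *m M) i j - \sum_k qconj (cross k j) * cross i k.
  rewrite !mxE raddf_sum -sumrB; apply: eq_bigr => k _.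
  by rewrite !mxE.
have sndE : (omulmx (cayley_mx M) (cayley_mx M) i j).2 =
    \sum_k (cross k j * M i k + cross i k * M j k).
  rewrite !mxE raddf_sum; apply: eq_bigr => k _.
  by rewrite !mxE /= hM.
have tr3 : M i i + M (i + 1) (i + 1) + M (i + 2%:R) (i + 2%:R) = 0.
  by rewrite -(sum_I3 _ (fun k => M k k)).
have oct0 : (0 : oct K) = (0, 0) by [].
rewrite [RHS]mxE oct0 [LHS]surjective_pairing fstE sndE sqrM.
congr pair; apply/eqP.
- case: (I3_cases i j) => ->.
  (* Both norms N(a_(i+1)) and N(a_(i+2)) come from cross(a), N(a_i) from M^2. *)
  + rewrite eqxx !(sum_I3 _ _ i) !crossE !linearN !linear0 /=.
    rewrite !(mulr0, mulrN, mulNr, add0r).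
    by rewrite -addrA opprD addNKr opprD subr_eq0 addrC.
  + rewrite I3_neq mulr0n subr0 (sum_I3 _ _ i) !crossE !linearN !linear0 /=.
    by rewrite !(mulr0, mul0r, mulrN, mulNr, add0r, opprK) subrr.
  + rewrite I3_neq mulr0n subr0 (sum_I3 _ _ i) !crossE !linearN !linear0 /=.
    by rewrite !(mulr0, mul0r, mulrN, mulNr, add0r, addr0) subrr.
- case: (I3_cases i j) => ->.
  (* The two terms cancel for each k separately, cross(a) being skew. *)
  + by rewrite big1 // => k _; rewrite cross_anti mulNr addNr.
  (* The sum is a_(i+2) tr M minus the relation for column i+2. *)
  + have tr01 : M i i + M (i + 1) (i + 1) = - M (i + 2%:R) (i + 2%:R).
      by apply/eqP; rewrite -addr_eq0 tr3.
    have := rowM (i + 2%:R); rewrite (sum_I3 _ _ i) => row2.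
    rewrite (sum_I3 _ _ i) !crossE !mul0r addr0 add0r -mulrDr tr01.
    by rewrite mulrN !mulNr -!opprD oppr_eq0 addrC row2.
  (* The sum is the relation for column i+1 minus a_(i+1) tr M. *)
  + have tr02 : M i i + M (i + 2%:R) (i + 2%:R) = - M (i + 1) (i + 1).
      by apply/eqP; rewrite -addr_eq0 addrAC tr3.
    have := rowM (i + 1); rewrite (sum_I3 _ _ i) => row1.
    rewrite (sum_I3 _ _ i) !crossE !mul0r addr0 add0r !mulNr addrAC.
    by rewrite -opprD -mulrDr tr02 mulrN opprK addrCA addrA row1.
Qed.

End CrossMatrix.

(** * The 2x2 complex model of the quaternions *)

Section Rho.
Variable R : rcfType.
Local Notation C := R[i].
Local Notation ii := ('i%C : C).

Lemma mulii : ii * ii = -1.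
Proof. by rewrite -expr2 sqr_i. Qed.

Lemma mul_scale_ii (p q : quat C) : (ii *: p) * (ii *: q) = - (p * q).
Proof. by rewrite -scalerAl -scalerAr scalerA mulii scaleN1r. Qed.

Lemma mx2P (P Q : 'M[C]_2) :
  P 0 0 = Q 0 0 -> P 0 1 = Q 0 1 -> P 1 0 = Q 1 0 -> P 1 1 = Q 1 1 -> P = Q.
Proof.
have I2_cases (i : 'I_2) : i = 0 \/ i = 1.
  by case: i => [[|[|i]] hi] //; [left | right]; apply: val_inj.
move=> h00 h01 h10 h11; apply/matrixP => i j.
by case: (I2_cases i) (I2_cases j) => -> [] ->.
Qed.

Lemma mx2E (a b c d : C) :
  (mx2 a b c d 0 0 = a) * (mx2 a b c d 0 1 = b)
  * (mx2 a b c d 1 0 = c) * (mx2 a b c d 1 1 = d).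
Proof. by do !split; rewrite mxE. Qed.

Lemma mulmx2E (P Q : 'M[C]_2) i j :
  (P *m Q) i j = P i 0 * Q 0 j + P i 1 * Q 1 j.
Proof.
rewrite mxE !big_ord_recl big_ord0 addr0.
by rewrite (_ : lift _ _ = 1) //; apply: val_inj.
Qed.

Fact rho2_is_linear : linear (@rho2 R).
Proof.
by move=> c p q; apply: mx2P; rewrite !mxE /= !(qcoD, qcoZ); ring.
Qed.
HB.instance Definition _ :=
  GRing.isLinear.Build C (quat C) 'M[C]_2 *:%R (@rho2 R) rho2_is_linear.

Lemma rho2_scalar (c : C) : rho2 (c *: (1 : quat C)) = c%:M.
Proof.
by apply: mx2P; rewrite mx2E !mxE /= !(qcoZ, qcoE); ring.
Qed.

Lemma rho2M (p q : quat C) : rho2 (p * q) = rho2 p *m rho2 q.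
Proof.
by apply: mx2P; rewrite mulmx2E !mx2E !qcoE; ring: mulii.
Qed.

Definition rho2V (B : 'M[C]_2) : quat C :=
  mkq (2^-1 * (B 0 0 + B 1 1)) (ii * 2^-1 * (B 1 1 - B 0 0))
      (2^-1 * (B 0 1 - B 1 0)) (- ii * 2^-1 * (B 0 1 + B 1 0)).

Let half2 : 2^-1 * 2 = 1 :> C.
Proof. by rewrite mulVf // Num.Theory.pnatr_eq0. Qed.

Lemma rho2VK : cancel rho2V (@rho2 R).
Proof.
by move=> B; apply: mx2P; rewrite mx2E !qcoE; ring: mulii half2.
Qed.

Lemma rho2K : cancel (@rho2 R) rho2V.
Proof.
by move=> z; apply: qcoP; rewrite !qcoE !mx2E; ring: mulii half2.
Qed.

(** Conjugating by J turns the transpose of a 2x2 matrix into its adjugate, and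
    the adjugate of rho(z) is rho of the conjugate of z. *)
Lemma J2_rho2_conj z : J2 R *m rho2 (qconj z) = (rho2 z)^T *m J2 R.
Proof.
by apply: mx2P; rewrite !mulmx2E ![_^T _ _]mxE !mx2E !qcoE; ring.
Qed.

Lemma mulJ2_inj : injective (mulmx (J2 R) : 'M[C]_2 -> 'M_2).
Proof.
have J2J2 : - J2 R *m J2 R = 1%:M.
  by apply: mx2P; rewrite mulNmx mxE mulmx2E !mx2E mxE /=; ring.
by move=> P Q /(congr1 (mulmx (- J2 R))); rewrite !mulmxA J2J2 !mul1mx.
Qed.

(** * Block structure of 8x8 matrices *)

Lemma block2M (A B : 'M[C]_8) i j :
  block2 (A *m B) i j = \sum_k block2 A i k *m block2 B k j.
Proof.
apply/matrixP => k l; rewrite !mxE summxE.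
under [RHS]eq_bigr => m _ do rewrite mxE.
rewrite pair_big /= (reindex (@mxtens_index 4 2)) /=; last first.
  by exists (@mxtens_unindex 4 2) => p _; rewrite ?mxtens_indexK ?mxtens_unindexK.
by apply: eq_bigr => -[m n] _; rewrite !mxE.
Qed.

Lemma block2_tr (A : 'M[C]_8) i j : block2 A^T i j = (block2 A j i)^T.
Proof. by apply/matrixP => k l; rewrite !mxE. Qed.

Lemma block2_scalar (c : C) i j : block2 c%:M i j = (c *+ (i == j))%:M.
Proof.
apply/matrixP => k l; rewrite !mxE (can_eq (@mxtens_indexK 4 2)) xpair_eqE.
by case: (i == j); rewrite ?mul0rn.
Qed.

Lemma block2_JJ i j : block2 (JJ R) i j = J2 R *+ (i == j).
Proof.
apply/matrixP => k l; rewrite mxE tensmxE mxE.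
by case: (i == j); rewrite ?mul1r // mul0r mxE.
Qed.

Lemma block2_JJM (A : 'M[C]_8) i j :
  block2 (JJ R *m A) i j = J2 R *m block2 A i j.
Proof.
rewrite block2M (bigD1 i) //= block2_JJ eqxx big1 ?addr0 // => k ki.
by rewrite block2_JJ eq_sym (negPf ki) mul0mx.
Qed.

Lemma block2_MJJ (A : 'M[C]_8) i j :
  block2 (A *m JJ R) i j = block2 A i j *m J2 R.
Proof.
rewrite block2M (bigD1 j) //= block2_JJ eqxx big1 ?addr0 // => k kj.
by rewrite block2_JJ (negPf kj) mulmx0.
Qed.

Definition quat_mx (A : 'M[C]_8) : 'M[quat C]_4 :=
  \matrix_(i, j) rho2V (block2 A i j).

Lemma rho2_quat_mx A i j : rho2 (quat_mx A i j) = block2 A i j.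
Proof. by rewrite mxE rho2VK. Qed.

Lemma rho_quat_mx : cancel quat_mx (@rho R).
Proof.
move=> A; apply/matrixP => p q; rewrite mxE rho2_quat_mx mxE.
by rewrite -!surjective_pairing !mxtens_unindexK.
Qed.

Lemma quat_mxM (A B : 'M[C]_8) : quat_mx (A *m B) = quat_mx A *m quat_mx B.
Proof.
apply/matrixP => i j; apply: (can_inj rho2K).
rewrite rho2_quat_mx block2M mxE raddf_sum; apply: eq_bigr => k _.
by rewrite /= rho2M !rho2_quat_mx.
Qed.

Lemma quat_mx_scalar (c : C) : quat_mx c%:M = (c *: (1 : quat C))%:M.
Proof.
apply/matrixP => i j; apply: (can_inj rho2K).
rewrite rho2_quat_mx block2_scalar mxE.
by case: (i == j); rewrite ?rho2_scalar //= !raddf0.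
Qed.

(** Block (j, i) of JJ A = A^T JJ reads J A_ji = (A_ij)^T J, and the right hand
    side is J rho(conj(h)) when A_ij = rho(h). *)
Lemma qconj_quat_mx (A : 'M[C]_8) : JJ R *m A = A^T *m JJ R ->
  forall i j, qconj (quat_mx A i j) = quat_mx A j i.
Proof.
move=> JA i j; apply: (can_inj rho2K); apply: mulJ2_inj.
rewrite J2_rho2_conj !rho2_quat_mx.
by rewrite -block2_JJM JA block2_MJJ block2_tr.
Qed.

End Rho.

(** * Preimages under g *)

Section Decomposition.
Variable R : rcfType.
Local Notation C := R[i].
Local Notation ii := ('i%C : C).
Variable H : 'M[quat C]_(1 + 3).
Hypothesis H_conj : forall i j, qconj (H i j) = H j i.
Hypothesis H00 : H 0 0 = 0.
Let M : 'M[quat C]_3 := drsubmx H.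
Hypothesis trM : \tr M = 0.
Let u : 'rV[quat C]_3 := ursubmx H.
Let a (j : 'I_3) : quat C := - ii *: u 0 j.

Let ulH : ulsubmx H = 0.
Proof.
apply/matrixP => i j; rewrite !mxE !ord1 -[RHS]H00.
by congr (H _ _); apply: val_inj.
Qed.

Let uE j : u 0 j = ii *: a j.
Proof. by rewrite /a scalerA mulrN mulii opprK scale1r. Qed.

Let dlE j : dlsubmx H j 0 = ii *: qconj (a j).
Proof. by rewrite -linearZ -uE /= !mxE H_conj. Qed.

Let M_conj i j : qconj (M i j) = M j i.
Proof. by rewrite !mxE H_conj. Qed.

(** The only candidate for a preimage: g multiplies the e4-components by i,
    which is undone by the factor - i in a. *)
Definition ginv : 'M[oct C]_3 := cayley_mx C a M.

Lemma ginv_J3 : ginv \in J3 C.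
Proof. exact: cayley_mx_J3. Qed.

Lemma ginvK : g ginv = H.
Proof.
have gME : gM ginv = M by apply/matrixP => i j; rewrite !mxE.
have gaE j : ga ginv j = a j.
  have j3 : j + 1 + 2%:R = j by apply/eqP; case: j => [[|[|[|j]]] hj].
  have j2 : j + 2%:R = j + 1 + 1 by apply/eqP; case: j {j3} => [[|[|[|j]]] hj].
  by rewrite /ga mxE j2 /= crossE j3.
have ur : \row_j (ii *: ga ginv j) = ursubmx H.
  by apply/rowP => j; rewrite mxE gaE -uE.
have dl : \col_j (ii *: qconj (ga ginv j)) = dlsubmx H.
  by apply/colP => j; rewrite mxE gaE -dlE.
by rewrite /g gME trM scaler0 !raddf0 addr0 ur dl -ulH submxK.
Qed.

Lemma ginv_sqr0 (c : C) : H *m H = (c *: (1 : quat C))%:M ->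
  omulmx ginv ginv = 0.
Proof.
rewrite -[H]submxK ulH mulmx_block (scalar_mx_block 1 3).
case/eq_block_mx; rewrite !mul0mx !add0r => ul ur _ dr.
(* The corner of H^2 is sum_l (i a_l) (i conj(a_l)). *)
have cE : c *: (1 : quat C) = - \sum_l qconj (a l) * a l.
  have := congr1 (fun B : 'M_1 => B 0 0) ul.
  rewrite [in RHS]mxE eqxx mulr1n mxE => <-; rewrite -sumrN; apply: eq_bigr => j _.
  by rewrite uE dlE mul_scale_ii mul_qconjC.
apply: cayley_mx_sqr0 => // [k|j k].
- have := congr1 (fun B : 'rV_3 => - ii *: B 0 k) ur.
  rewrite [in RHS]mxE scaler0 => urk; rewrite -[RHS]urk mxE scaler_sumr.
  by apply: eq_bigr => j _; rewrite /a -scalerAl.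
- have := congr1 (fun B : 'M_3 => B j k) dr.
  rewrite mxE [in RHS]mxE cE mulNrn => <-.
  rewrite [(dlsubmx H *m u) j k]mxE big_ord1 uE dlE mul_scale_ii.
  by rewrite addrA subrr add0r.
Qed.

End Decomposition.

Theorem proposition5p2 (R : realType) (A : 'M[R[i]]_8) (xi1 xi2 xi3 : R[i]) :
  A != 0 ->
  JJ R *m A = A^T *m JJ R ->
  (exists lambda : R[i], A *m A = lambda%:M) ->
  \tr A = 0 ->
  block2 A 0 0 = 0 ->
  block2 A 1 1 = xi1%:M ->
  block2 A 2%:R 2%:R = xi2%:M ->
  block2 A 3%:R 3%:R = xi3%:M ->
  xi1 + xi2 + xi3 = 0 ->
  exists X : 'M[oct R[i]]_3,
    [/\ X \in J3 R[i], jordan X X = 0 & rho (g X) = A].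
Proof.
move=> _ JA [c sqrA] _ A00 A11 A22 A33 xi0.
pose H : 'M[quat R[i]]_(1 + 3) := quat_mx R A.
have H_conj : forall i j, qconj (H i j) = H j i := qconj_quat_mx R A JA.
have H00 : H 0 0 = 0.
  by apply: (can_inj (rho2K R)); rewrite rho2_quat_mx A00 linear0.
have blockM (j : 'I_3) :
    rho2 (drsubmx H j j) = block2 A (rshift 1 j) (rshift 1 j).
  by rewrite -rho2_quat_mx; congr rho2; rewrite 2!mxE.
have trM : \tr (drsubmx H) = 0.
  apply: (can_inj (rho2K R)); rewrite linear0 raddf_sum.
  rewrite !big_ord_recl big_ord0 addr0 /=.
  rewrite !blockM.
  rewrite (_ : rshift 1 0 = 1) ?A11; last exact: val_inj.
  rewrite (_ : rshift 1 (lift 0 0) = 2%:R) ?A22; last exact: val_inj.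
  rewrite (_ : rshift 1 (lift 0 (lift 0 0)) = 3%:R) ?A33; last exact: val_inj.
  by rewrite -!raddfD addrA xi0 raddf0.
have sqrH : H *m H = (c *: (1 : quat R[i]))%:M.
  by rewrite -quat_mxM sqrA quat_mx_scalar.
exists (ginv R H); split.
- exact: ginv_J3.
- rewrite /jordan (ginv_sqr0 _ _ H_conj H00 trM c sqrH) addr0.
  by apply/matrixP => i j; rewrite !mxE scaler0.
- by rewrite (ginvK _ _ H_conj H00 trM) rho_quat_mx.
Qed.
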